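(* Let $V=\mathbb{R}^n$ or $V=\mathbb{R}^N_0$, and let $R,R'\subset V$ be finite collections of points such that the convex hulls $\mathcal{I}(R)$ and $\mathcal{I}(R')$ are balanced and absorbing in $V$. Then the norm corresponding to $\mathcal{I}(R\cup R')$ is the infimal convolution of the norms corresponding to $\mathcal{I}(R)$ and $\mathcal{I}(R')$; that is, if one defines, for $y\in V$, $$\|y\|_{\mathcal{I}(R\cup R')}:=\inf_{x\in V}\left(\|x\|_{\mathcal{I}(R)}+\|y-x\|_{\mathcal{I}(R')}\right),$$ then $\mathcal{I}(R\cup R')=\{y\in V:\|y\|_{\mathcal{I}(R\cup R')}\le1\}$.
   Context: $\mathbb{R}^N_0=\{x\in\mathbb{R}^N:\sum_{i=1}^N x_i=0\}$. For a finite set $R\subset V$, $\mathcal{I}(R)$ denotes the convex hull of $R$. A set $B\subseteq V$ is balanced if $x\in B\Rightarrow -x\in B$, and absorbing if for every $x\in V$ there is $\lambda>0$ with $\lambda x\in B$. If $\mathcal{I}(R)$ is balanced and absorbing, it is the closed unit ball of the seminorm $\|x\|_{\mathcal{I}(R)}=\inf\{\lambda\in(0,\infty):\lambda^{-1}x\in\mathcal{I}(R)\}$; this is the norm corresponding to $\mathcal{I}(R)$, and likewise for $R'$. *)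

(* Defs.v *)
From mathcomp Require Import all_boot all_order all_algebra.
From mathcomp Require Import all_classical all_reals all_analysis.
Set Implicit Arguments.
Unset Strict Implicit.
Unset Printing Implicit Defensive.
Import Order.TTheory GRing.Theory Num.Theory.
Local Open Scope classical_set_scope.
Local Open Scope ring_scope.

Definition zero_sum (R : realType) (n : nat) : set 'rV[R]_n :=
  [set x | \sum_(i < n) x 0 i = 0].
Arguments zero_sum : clear implicits.

Definition convex_hull (R : realType) (M : lmodType R) (A : set M) : set M :=
  smallest (@convex_set R M) A.

(* Only symmetry under x |-> - x: weaker than the usual notion of a balanced
   set in functional analysis when the set is not convex. *)
Definition balanced (R : realType) (M : lmodType R) (B : set M) : Prop :=
  forall x, B x -> B (- x).

Definition absorbing_in (R : realType) (M : lmodType R) (V B : set M) : Prop :=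
  forall x, V x -> exists2 l : R, 0 < l & B (l *: x).

(* [inf] is the real-valued infimum, with the junk value 0 on the empty set;
   the set below is nonempty for x in V whenever B is absorbing in V. *)
Definition unit_ball_norm (R : realType) (M : lmodType R) (B : set M) (x : M)
    : R :=
  inf [set l : R | 0 < l /\ B (l^-1 *: x)].

Definition inf_convolution (R : realType) (M : lmodType R) (V : set M)
    (f g : M -> R) (y : M) : R :=
  inf [set f x + g (y - x) | x in V].

(* Main.v *)
(* The hull of A `|` A' is the join of the hulls K and K' of A and A'. Writing y
   in l times the join as y = x + (y - x) with x in (l t) K and y - x in
   (l (1 - t)) K' and, conversely, reading such a decomposition as a convex
   combination identifies the gauge of the join with the infimal convolution of
   the two gauges. That the gauge ball {y | gauge y <= 1} is the hull itself,
   and not a larger set, requires the hull to be closed: adding the points one at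
   a time exhibits it as an iterated join, a continuous image of a compact set. *)
Require Import Defs.
From mathcomp Require Import all_boot all_order all_algebra.
From mathcomp Require Import all_classical all_reals all_analysis.
From mathcomp Require Import ring lra.
Set Implicit Arguments.
Unset Strict Implicit.
Unset Printing Implicit Defensive.
Import Order.TTheory GRing.Theory Num.Theory numFieldNormedType.Exports.
Local Open Scope classical_set_scope.
Local Open Scope ring_scope.

(** A map of a single tuple, so that the join below is an image and inherits compactness by
    continuity. *)
Definition segment_comb (R : realType) (M : lmodType R) (p : R * (M * M)) : M :=
  p.1 *: p.2.1 + (1 - p.1) *: p.2.2.

Definition convex_join (R : realType) (M : lmodType R) (K L : set M) : set M :=
  @segment_comb _ _ @` (`[0, 1] `*` (K `*` L)).

(** Trades the interval-typed weights of [convex_set] for a real [t] with two inequalities, which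
    arithmetic tactics can handle. *)
Lemma convex_setE (R : realType) (M : lmodType R) (K : set M) :
  convex_set K <-> forall (x y : M) (t : R), 0 <= t -> t <= 1 -> K x -> K y ->
    K (t *: x + (1 - t) *: y).
Proof.
split=> [cK x y t t0 t1 Kx Ky|cK x y t].
  have := cK x y (Itv01 t0 t1); rewrite !inE; exact.
by rewrite !inE; apply: cK.
Qed.

Lemma convex_set_hull (R : realType) (M : lmodType R) (A : set M) :
  convex_set (convex_hull A).
Proof.
apply/convex_setE => x y t t0 t1 Ax Ay K [cK AK].
by move/convex_setE: (cK); apply=> //; [exact: Ax|exact: Ay].
Qed.

Lemma convex_hullS (R : realType) (M : lmodType R) (A B : set M) :
  A `<=` B -> convex_hull A `<=` convex_hull B.
Proof. by apply: sub_smallest2r; exact: convex_set_hull. Qed.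

(** Dividing by [a + b] makes the weights convex; if the sum vanishes, both weights are zero and any
    point serves. *)
Lemma convex_set_conic (R : realType) (M : lmodType R) (K : set M) (x y : M)
    (a b : R) :
  convex_set K -> K x -> K y -> 0 <= a -> 0 <= b ->
  exists2 z, K z & a *: x + b *: y = (a + b) *: z.
Proof.
move=> /convex_setE cK Kx Ky a0 b0.
have [ab0|ab0] := eqVneq (a + b) 0.
  exists x => //; have -> : a = 0 by lra.
  have -> : b = 0 by lra.
  by rewrite addr0 !scale0r addr0.
have ab : 0 < a + b by rewrite lt_def ab0 addr_ge0.
exists ((a / (a + b)) *: x + (1 - a / (a + b)) *: y).
  apply: cK => //; first by rewrite divr_ge0// ltW.
  by rewrite ler_pdivrMr// mul1r lerDl.
by rewrite scalerDr !scalerA; congr (_ *: _ + _ *: _); field.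
Qed.

Lemma convex_set_join (R : realType) (M : lmodType R) (K L : set M) :
  convex_set K -> convex_set L -> convex_set (convex_join K L).
Proof.
move=> cK cL; apply/convex_setE => x y u u0 u1.
move=> [[t [a b]] /= [+ [Ka Lb]] <-] [[s [c d]] /= [+ [Kc Ld]] <-].
rewrite /segment_comb /= !in_itv /= => /andP[t0 t1] /andP[s0 s1].
have u10 : 0 <= 1 - u by rewrite subr_ge0.
have t10 : 0 <= 1 - t by rewrite subr_ge0.
have s10 : 0 <= 1 - s by rewrite subr_ge0.
(* Expanding the combination gives two terms from [K] and two from [L]; each pair merges into one
   point of its set, with total weights still summing to 1. *)
have [e Ke ace] := convex_set_conic cK Ka Kc (mulr_ge0 u0 t0) (mulr_ge0 u10 s0).
have [f Lf bdf] :=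
  convex_set_conic cL Lb Ld (mulr_ge0 u0 t10) (mulr_ge0 u10 s10).
exists (u * t + (1 - u) * s, (e, f)) => /=.
  by split=> //=; rewrite in_itv /=; apply/andP; split; nra.
rewrite /segment_comb /= -ace.
have -> : 1 - (u * t + (1 - u) * s) = u * (1 - t) + (1 - u) * (1 - s) by ring.
by rewrite -bdf !scalerDr !scalerA addrACA.
Qed.

(** The join is convex and contains [A] at weight 1 and [B] at weight 0, so minimality of the hull
    applies. Each endpoint needs a partner from the other set: a join with the empty set is
    empty. *)
Lemma convex_hullU (R : realType) (M : lmodType R) (A B : set M) :
  A !=set0 -> B !=set0 ->
  convex_hull (A `|` B) = convex_join (convex_hull A) (convex_hull B).
Proof.
move=> [a Aa] [b Bb]; apply/seteqP; split.
  apply: smallest_sub; first by apply: convex_set_join; exact: convex_set_hull.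
  move=> x [Ax|Bx].
    exists (1, (x, b)) => /=; last first.
      by rewrite /segment_comb /= subrr scale0r addr0 scale1r.
    by split; [rewrite /= in_itv /= ler01 lexx|split; exact: sub_gen_smallest].
  exists (0, (a, x)) => /=; last first.
    by rewrite /segment_comb /= scale0r add0r subr0 scale1r.
  by split; [rewrite /= in_itv /= ler01 lexx|split; exact: sub_gen_smallest].
move=> _ [[t [x y]] /= [+ [Ax By]] <-]; rewrite in_itv /= => /andP[t0 t1].
move/convex_setE: (@convex_set_hull _ _ (A `|` B)); apply=> //.
  by apply: convex_hullS Ax; exact: subsetUl.
by apply: convex_hullS By; exact: subsetUr.
Qed.

Lemma compact_convex_join (R : realType) (M : normedModType R) (K L : set M) :
  compact K -> compact L -> compact (convex_join K L).
Proof.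
move=> cK cL; apply: continuous_compact; last first.
  by apply: compact_setX; [exact: segment_compact|exact: compact_setX].
apply: continuous_subspaceT => p; apply: cvgD; apply: cvgZ.
- exact: cvg_fst.
- by apply: cvg_comp; [exact: cvg_snd|exact: cvg_fst].
- by apply: cvgB; [exact: cvg_cst|exact: cvg_fst].
- by apply: cvg_comp; [exact: cvg_snd|exact: cvg_snd].
Qed.

Lemma convex_hull0 (R : realType) (M : lmodType R) :
  convex_hull (set0 : set M) = set0.
Proof.
apply: smallest_id; apply/convex_setE => x y t _ _ [].
Qed.

Lemma convex_hull1 (R : realType) (M : lmodType R) (a : M) :
  convex_hull [set a] = [set a].
Proof.
apply: smallest_id; apply/convex_setE => x y t _ _ -> ->.
by rewrite -scalerDl subrKC scale1r.
Qed.

Lemma compact_convex_hull (R : realType) (M : normedModType R) (A : set M) :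
  finite_set A -> compact (convex_hull A).
Proof.
move=> /finite_seqP[s ->]; elim: s => [|a s IHs].
  by rewrite set_nil convex_hull0; exact: compact0.
have -> : [set` a :: s] = a |` [set` s].
  by apply/seteqP; split=> x /=; rewrite in_cons => /predU1P.
(* The last remaining point is handled apart, since its join with an empty hull would lose it. *)
have [->|/set0P s0] := eqVneq [set` s] set0.
  by rewrite setU0 convex_hull1; exact: compact_set1.
rewrite convex_hullU//; last by exists a.
by apply: compact_convex_join => //; rewrite convex_hull1; exact: compact_set1.
Qed.

Lemma unit_ball_norm_ge0 (R : realType) (M : lmodType R) (B : set M) (x : M) :
  0 <= unit_ball_norm B x.
Proof.
rewrite /unit_ball_norm; set S := [set l | _].
have [->|/set0P S0] := eqVneq S set0; first by rewrite inf0.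
by apply: lb_le_inf => // l [/ltW].
Qed.

Lemma unit_ball_norm_le (R : realType) (M : lmodType R) (B : set M) (x : M)
    (l : R) :
  0 < l -> B (l^-1 *: x) -> unit_ball_norm B x <= l.
Proof. by move=> l0 Bx; apply: ge_inf => //; exists 0 => m [/ltW]. Qed.

Lemma absorbing_scales_neq0 (R : realType) (M : lmodType R) (V B : set M) (x : M) :
  absorbing_in V B -> V x -> [set l : R | 0 < l /\ B (l^-1 *: x)] !=set0.
Proof.
by move=> /[apply] -[l l0 Bl]; exists l^-1; rewrite /= invrK invr_gt0.
Qed.

(** Some admissible scale [m] lies below [l], and [l^-1 *: x] is the combination of [m^-1 *: x] and
    0 with weight [m / l]. That 0 lies in [B] comes from absorbing the vector 0. *)
Lemma unit_ball_norm_lt (R : realType) (M : lmodType R) (V B : set M) (x : M)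
    (l : R) :
  V 0 -> absorbing_in V B -> convex_set B -> V x ->
  unit_ball_norm B x < l -> B (l^-1 *: x).
Proof.
move=> V0 aB cB Vx xl.
have [m [m0 Bm] ml] := inf_lt (absorbing_scales_neq0 aB Vx) xl.
have [k _] := aB _ V0; rewrite scaler0 => B0.
move/convex_setE: cB => /(_ (m^-1 *: x) 0 (m / l)).
have l0 := lt_trans m0 ml.
rewrite scaler0 addr0 scalerA.
have -> : m / l / m = l^-1 by field; rewrite !gt_eqF.
by apply=> //; [rewrite divr_ge0 ?ltW|rewrite ler_pdivrMr// mul1r ltW].
Qed.

Lemma unit_ball_norm_convex_join (R : realType) (M : lmodType R)
    (V K L : set M) (y : M) :
  V 0 -> (forall (l : R) x, V x -> V (l *: x)) ->
  (forall x z, V x -> V z -> V (x - z)) ->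
  convex_set K -> convex_set L -> K `<=` V ->
  absorbing_in V K -> absorbing_in V L -> absorbing_in V (convex_join K L) ->
  V y ->
  unit_ball_norm (convex_join K L) y =
    inf_convolution V (unit_ball_norm K) (unit_ball_norm L) y.
Proof.
move=> V0 VZ VB cK cL KV aK aL aKL Vy; apply/eqP; rewrite eq_le; apply/andP; split.
  apply: lb_le_inf => [|_ [x Vx <-]].
    by exists (unit_ball_norm K y + unit_ball_norm L (y - y)), y.
  apply/ler_addgt0Pr => e e0.
  (* The slack makes both scales positive and strictly larger than the gauges, so they are
     admissible even where an infimum is not attained. *)
  set l := unit_ball_norm K x + e / 2; set m := unit_ball_norm L (y - x) + e / 2.
  have l0 : 0 < l by rewrite ltr_wpDl ?unit_ball_norm_ge0 ?divr_gt0.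
  have m0 : 0 < m by rewrite ltr_wpDl ?unit_ball_norm_ge0 ?divr_gt0.
  have Kl : K (l^-1 *: x).
    by apply: (unit_ball_norm_lt (V := V)) => //; rewrite ltrDl divr_gt0.
  have Lm : L (m^-1 *: (y - x)).
    apply: (unit_ball_norm_lt (V := V)) => //; first exact: VB.
    by rewrite ltrDl divr_gt0.
  have -> : unit_ball_norm K x + unit_ball_norm L (y - x) + e = l + m.
    by rewrite /l /m; field.
  have lm0 : 0 < l + m by rewrite addr_gt0.
  apply: unit_ball_norm_le => //.
  (* This weight gives both summands the common factor [(l + m)^-1], so that they add up to
     [(l + m)^-1 *: y]. *)
  exists (l / (l + m), (l^-1 *: x, m^-1 *: (y - x))) => /=.
    split=> //=; rewrite in_itv /= divr_ge0 ?ltW//=.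
    by rewrite ltr_pdivrMr// mul1r ltrDl.
  rewrite /segment_comb /= !scalerA.
  have -> : l / (l + m) / l = (l + m)^-1 by field; rewrite !gt_eqF.
  have -> : (1 - l / (l + m)) / m = (l + m)^-1 by field; rewrite !gt_eqF.
  by rewrite -scalerDr subrKC.
(* Conversely, every scale [l] admissible for the join bounds the infimal convolution. *)
apply: lb_le_inf => [|l [l0 [[t [a b]] /= [+ [Ka Lb]] yE]]].
  exact: absorbing_scales_neq0 aKL Vy.
rewrite in_itv /= => /andP[t0 t1].
have {}yE : y = (l * t) *: a + (l * (1 - t)) *: b.
  have -> : y = l *: (l^-1 *: y) by rewrite scalerA divff ?gt_eqF// scale1r.
  by rewrite -yE /segment_comb /= scalerDr !scalerA.
have lt0 : 0 <= l * t by rewrite mulr_ge0// ltW.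
(* Here [c] may be 0, which is no admissible scale; hence the detour through [c + e]. *)
have scale_le (B : set M) (x : M) (c : R) : B x -> absorbing_in V B ->
    convex_set B -> 0 <= c -> unit_ball_norm B (c *: x) <= c.
  move=> Bx aB /convex_setE cB c0; apply/ler_addgt0Pr => e e0.
  have ce0 : 0 < c + e by rewrite ltr_wpDl.
  apply: unit_ball_norm_le => //; have [k _] := aB _ V0; rewrite scaler0 => B0.
  have := cB x 0 (c / (c + e)); rewrite scaler0 addr0 scalerA [_^-1 * c]mulrC; apply=> //.
    by rewrite divr_ge0// ltW.
  by rewrite ler_pdivrMr// mul1r lerDl ltW.
(* Splitting [y] at [(l * t) *: a] leaves [(l * (1 - t)) *: b]; the two gauges are at most these
   coefficients, whose sum is [l]. *)
apply: (@le_trans _ _ (l * t + l * (1 - t))); last by nra.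
apply: (@le_trans _ _ (unit_ball_norm K ((l * t) *: a) +
    unit_ball_norm L (y - (l * t) *: a))).
  apply: ge_inf; last by exists ((l * t) *: a) => //; apply: VZ; exact: KV.
  by exists 0 => _ [x _ <-]; rewrite addr_ge0 ?unit_ball_norm_ge0.
apply: lerD; first exact: scale_le.
by rewrite yE addrAC subrr add0r; apply: scale_le => //; nra.
Qed.

(** For every [l > 1] the point [l^-1 *: y] lies in [C]; it tends to [y] as [l] decreases to 1. *)
Lemma closed_unit_ball_norm_le1 (R : realType) (M : normedModType R)
    (V C : set M) (y : M) :
  V 0 -> absorbing_in V C -> convex_set C -> closed C -> V y ->
  unit_ball_norm C y <= 1 -> C y.
Proof.
move=> V0 aC cC clC Vy y1.
apply: (@closed_cvg _ _ (1 : R)^'+ _ (fun l : R => l^-1 *: y) C clC) => //.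
  near=> l; apply: (unit_ball_norm_lt (V := V)) => //.
  by apply: le_lt_trans y1 _; near: l; exact: nbhs_right_gt.
rewrite -[X in _ --> X]scale1r -[X in _ --> X *: _]invr1.
apply: cvgZr_tmp; apply: cvgV => //; apply: cvg_at_right_filter; exact: cvg_id.
Unshelve. all: by end_near.
Qed.

Theorem proposition3p4 (R : realType) (n : nat) (V : set 'rV[R]_n)
  (hV : V = [set: 'rV[R]_n] \/ V = zero_sum R n)
  (A A' : set 'rV[R]_n)
  (finA : finite_set A) (finA' : finite_set A')
  (AV : A `<=` V) (A'V : A' `<=` V)
  (balA : balanced (convex_hull A)) (absA : absorbing_in V (convex_hull A))
  (balA' : balanced (convex_hull A')) (absA' : absorbing_in V (convex_hull A')) :
  let conv := inf_convolution V (unit_ball_norm (convex_hull A))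
                                (unit_ball_norm (convex_hull A')) in
  (forall y, V y -> unit_ball_norm (convex_hull (A `|` A')) y = conv y) /\
  convex_hull (A `|` A') = [set y | V y /\ conv y <= 1].
Proof.
have V0 : V 0.
  by case: hV => -> //=; rewrite /zero_sum /= big1// => i _; rewrite mxE.
have VZ (l : R) x : V x -> V (l *: x).
  case: hV => -> //=; rewrite /zero_sum /= => x0.
  by under eq_bigr do rewrite mxE; rewrite -mulr_sumr x0 mulr0.
have VB x z : V x -> V z -> V (x - z).
  case: hV => -> //=; rewrite /zero_sum /= => x0 z0.
  by under eq_bigr do rewrite !mxE; rewrite sumrB x0 z0 subrr.
have cV : convex_set V.
  apply/convex_setE => x y t _ _ Vx Vy; rewrite -[(1 - t) *: y]opprK -scaleNr.
  by apply: VB; exact: VZ.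
(* An empty hull could not absorb even the vector 0. *)
have nonempty B : absorbing_in V (convex_hull B) -> B !=set0.
  move=> aB; apply/set0P/eqP => B0; have [l _] := aB _ V0.
  by rewrite B0 convex_hull0.
have absU : absorbing_in V (convex_hull (A `|` A')).
  move=> x /absA[l l0 Al]; exists l => //.
  by apply: convex_hullS Al; exact: subsetUl.
move=> conv.
have convE y : V y -> unit_ball_norm (convex_hull (A `|` A')) y = conv y.
  rewrite convex_hullU in absU *; [|exact: nonempty|exact: nonempty].
  apply: unit_ball_norm_convex_join => //; try exact: convex_set_hull.
  exact: smallest_sub.
split=> //; apply/seteqP; split=> [y Cy|y [Vy]].
  have Vy : V y by apply: smallest_sub Cy => //; rewrite subUset.
  split=> //; rewrite -convE//; apply: unit_ball_norm_le => //.
  by rewrite invr1 scale1r.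
rewrite -convE//; apply: closed_unit_ball_norm_le1 V0 absU _ _ Vy.
  exact: convex_set_hull.
(* Finiteness enters here: the hull of finitely many points is compact, hence closed in a Hausdorff
   space. *)
apply: compact_closed; first exact: norm_hausdorff.
by apply: compact_convex_hull; rewrite finite_setU.
Qed.
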